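(* Let $\mathbb{V}=(V_1,\dots,V_n)$ be an $n$-tuple of commuting shifts of finite multiplicity on a non-zero Hilbert space. Then $Z(\operatorname{Ann}(\mathbb{V}))$ has dimension $1$.
   Context: Hilbert spaces are complex. An operator $V$ on a Hilbert space $\mathcal{H}$ is a shift if it is an isometry with $\bigcap_{j=0}^\infty V^j\mathcal{H}=\{0\}$; its multiplicity is $\dim\ker V^*$ (each $V_i$ is assumed to have finite multiplicity). $\operatorname{Ann}(\mathbb{V})=\{p\in\mathbb{C}[X_1,\dots,X_n]:p(V_1,\dots,V_n)=0\}$; for a set $S$ of polynomials, $Z(S)\subseteq\mathbb{C}^n$ is the common zero set, with dimension as a complex algebraic variety. *)

(* Defs.v *)
From HB Require Import structures.
From mathcomp Require Import all_boot all_order all_algebra.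
From mathcomp Require Import boolp classical_sets functions reals.
From mathcomp Require Import topology normedtype.
From mathcomp Require Import complex.
From mathcomp Require mpoly.

Set Implicit Arguments.
Unset Strict Implicit.
Unset Printing Implicit Defensive.
Import Order.TTheory GRing.Theory Num.Theory.
Local Open Scope classical_set_scope.
Local Open Scope ring_scope.

(* The library file mpoly is loaded but not imported: its notations are
   incompatible with those of the topology files. *)
Notation cpoly R n := (mpoly.mpoly n R[i]).

Section Operators.
Variables (R : realType) (H : completeNormedModType R[i]).
Variable dot : {dot H for @Num.conj R[i]}.

Definition is_shift (V : {linear H -> H}) : Prop :=
  (forall x, `|V x| = `|x|) /\
  \bigcap_j range (iter j V) = [set 0].

(* By the Riesz representation theorem the set below is a singleton when V is
   bounded, so that the default value 0 is then irrelevant. *)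
Definition adjoint (V : {linear H -> H}) (y : H) : H :=
  xget 0 [set z | forall x, dot (V x) y = dot x z].

Definition finite_dim (E : set H) : Prop :=
  exists m (e : 'I_m -> H),
    (forall i, E (e i)) /\
    (forall x, E x -> exists c : 'I_m -> R[i], x = \sum_i c i *: e i).

Definition finite_multiplicity (V : {linear H -> H}) : Prop :=
  finite_dim [set x | adjoint V x = 0].

Variable n : nat.

Definition monom_op (V : 'I_n -> {linear H -> H}) (m : mpoly.multinom n)
    : H -> H :=
  \big[comp/idfun]_(i < n) iter (mpoly.fun_of_multinom m i) (V i).

Definition poly_op (V : 'I_n -> {linear H -> H}) (p : cpoly R n) (x : H) : H :=
  \sum_(m <- mpoly.msupp p) mpoly.mcoeff m p *: monom_op V m x.

Definition Ann (V : 'I_n -> {linear H -> H}) : set (cpoly R n) :=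
  [set p | forall x, poly_op V p x = 0].

End Operators.

Section Varieties.
Variables (R : realType) (n : nat).
Local Notation affine_space := ('I_n -> R[i]).

Definition zero_set (S : set (cpoly R n)) : set affine_space :=
  [set a | forall p, S p -> mpoly.meval a p = 0].

Definition zariski_closed (A : set affine_space) : Prop :=
  exists S, A = zero_set S.

Definition zariski_irreducible (A : set affine_space) : Prop :=
  [/\ zariski_closed A, A !=set0 &
      forall B C, zariski_closed B -> zariski_closed C ->
        A = B `|` C -> A = B \/ A = C].

Definition irreducible_chain (Z : set affine_space) (d : nat)
    (F : 'I_d.+1 -> set affine_space) : Prop :=
  [/\ forall i, zariski_irreducible (F i),
      forall i, F i `<=` Z &
      forall i j : 'I_d.+1, (i < j)%N -> F i `<` F j].

(* Dimension as the supremum of the lengths of chains of irreducible closed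
   subsets. *)
Definition has_dim (Z : set affine_space) (d : nat) : Prop :=
  (exists F, @irreducible_chain Z d F) /\
  (forall e F, @irreducible_chain Z e F -> (e <= d)%N).

End Varieties.

(* Main.v *)
Require Import Defs.
From HB Require Import structures.
From mathcomp Require Import all_boot all_order all_algebra.
From mathcomp Require Import boolp classical_sets functions reals.
From mathcomp Require Import topology normedtype.
From mathcomp Require Import complex.
From mathcomp Require Import ring lra zify.
From mathcomp Require mpoly ssrcomplements.
Import -(notations) mpoly ssrcomplements.

Set Implicit Arguments.
Unset Strict Implicit.
Unset Printing Implicit Defensive.
Import Order.TTheory GRing.Theory Num.Theory.
Local Open Scope classical_set_scope.
Local Open Scope ring_scope.

(** The zero set of the annihilator has dimension at most one because the
    shifts satisfy many algebraic relations, and at least one because it has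
    infinitely many points.

    Relations ([algebraic_relation]). For every shift V_i and every polynomial q
    in the shifts there is a nonzero bivariate polynomial c with
    c(V_i, q(V)) = 0. Since V_i is a shift, a polynomial in the shifts is zero
    as soon as it kills the wandering subspace E, the orthogonal complement of
    the range of V_i ([annihilates_wandering]), which is finite-dimensional.
    If U is a product of shifts divisible by all the monomials of q, the vectors
    V_i^s q(V)^t e with e in E, s < a and t < b are orthogonal to the range of
    V_i^a U^b, whose codimension grows only linearly in a and b, while the
    number of pairs (s, t) is a b. So a linear dependency exists that holds
    simultaneously for a basis of E.

    Upper bound ([chain_length_le1]). Let F0 < F1 < F2 be irreducible closed
    subsets, and q a polynomial vanishing on F1 but not on F2. After cancelling
    powers of q in c(x_i, q) = 0 on F2, restriction to F1 gives a nontrivial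
    equation c(x_i, 0) = 0 for each i. Hence all the coordinates are constant on
    F1, which is a point and cannot contain F0 strictly.

    Lower bound. For small z the operator V_i - z is not onto
    ([shift_sub_not_onto]). The relations between V_i and the V_j make each V_j
    algebraic on the quotient by its range, for all but finitely many z;
    successive eigenvalues a_j then give a point a of the zero set with a_i = z
    ([zero_set_Ann_dense_projection]). The zero set is therefore infinite, and
    by Noetherianity ([ideal_finite_zero_set], from Dickson's lemma) it contains
    a minimal closed set with infinite projection, which is irreducible; with
    one of its points it forms a chain of length one
    ([dense_projection_chain]). *)

(** * Orthogonal projection onto the range of an isometry *)

Section Hilbert.
Variables (R : realType) (H : completeNormedModType R[i]).
Variable dot : {dot H for @Num.conj R[i]}.
Hypothesis dot_norm : forall x : H, dot x x = `|x| ^+ 2.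
Local Notation C := R[i].
Local Notation "x %:C" := (real_complex R x) : ring_scope.

(** Norms take values in the partially ordered field of complex numbers;
    this real-valued version gives access to infima and to linear arithmetic. *)
Definition sq (x : H) : R := complex.Re (`|x| ^+ 2).

Lemma sqE x : (sq x)%:C = `|x| ^+ 2.
Proof. by rewrite RRe_real // realX. Qed.

Lemma dotDl x y z : dot (x + y) z = dot x z + dot y z.
Proof. exact: linearDl. Qed.
Lemma dotDr x y z : dot x (y + z) = dot x y + dot x z.
Proof. exact: linearDr. Qed.
Lemma dotBl x y z : dot (x - y) z = dot x z - dot y z.
Proof. exact: linearBl. Qed.
Lemma dotBr x y z : dot x (y - z) = dot x y - dot x z.
Proof. exact: linearBr. Qed.
Lemma dotZl a x z : dot (a *: x) z = a * dot x z.
Proof. exact: linearZl_LR. Qed.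
Lemma dotZr a x z : dot x (a *: z) = a^* * dot x z.
Proof. exact: linearZr_LR. Qed.
Lemma dot0r x : dot x 0 = 0.
Proof. exact: linear0r. Qed.
Lemma dotC x y : dot x y = (dot y x)^*.
Proof. by rewrite hermC expr0 mul1r. Qed.
Lemma dot_suml (I : Type) (r : seq I) (P : pred I) (F : I -> H) y :
  dot (\sum_(i <- r | P i) F i) y = \sum_(i <- r | P i) dot (F i) y.
Proof. exact: linear_sumlz. Qed.
Lemma dot_sumr (I : Type) (r : seq I) (P : pred I) (F : I -> H) y :
  dot y (\sum_(i <- r | P i) F i) = \sum_(i <- r | P i) dot y (F i).
Proof. exact: linear_sumr. Qed.

Lemma dot_eq0 x : dot x x = 0 -> x = 0.
Proof. by move/eqP; rewrite dot_norm sqrf_eq0 normr_eq0 => /eqP. Qed.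

Lemma dot_cauchy_schwarz u v : `|dot u v| ^+ 2 <= `|u| ^+ 2 * `|v| ^+ 2.
Proof.
have [->|v0] := eqVneq v 0; first by rewrite dot0r !normr0 expr2 mul0r mulr0.
rewrite -!dot_norm; set a := dot v v; set c := dot u v.
(* Expand the square norm of a u - c v, orthogonal to v. *)
have a0 : 0 < a by rewrite /a dot_norm exprn_gt0 // normr_gt0.
have : 0 <= dot (a *: u - c *: v) (a *: u - c *: v).
  by rewrite dot_norm exprn_ge0.
rewrite dotBl !dotBr !dotZl !dotZr -/a -/c (dotC v u) -/c.
have -> : a^* = a by apply/conj_Creal/gtr0_real.
rewrite normCK.
have -> : a * (a * dot u u) - a * (c^* * c) - (c * (a * c^*) - c * (c^* * a))
   = a * (dot u u * a - c * c^*) by ring.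
by rewrite pmulr_rge0 // subr_ge0.
Qed.

Lemma parallelogram (u v : H) :
  `|u - v| ^+ 2 = 2 * `|u| ^+ 2 + 2 * `|v| ^+ 2 - `|u + v| ^+ 2.
Proof. by rewrite -!dot_norm !(dotBl, dotBr, dotDl, dotDr); ring. Qed.

Lemma complete_seq (u : nat -> H) :
  (forall e : R, 0 < e -> exists N, forall n m, (N <= n)%N -> (N <= m)%N ->
     sq (u n - u m) < e) ->
  exists l, forall e : R, 0 < e -> exists N, forall n, (N <= n)%N ->
     sq (l - u n) < e.
Proof.
move=> uC.
have lesq (e : R) (x : H) : 0 < e -> (`|x| < e%:C) = (sq x < e ^+ 2).
  move=> e0; rewrite -ltcR sqE rmorphXn /= ltr_pXn2r //; first by rewrite nnegrE.
  by rewrite nnegrE lecR ltW.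
have cvu : cvgn u.
  apply: cauchy_cvg; apply: cauchy_exP => e e0.
  have eR : e = (complex.Re e)%:C by rewrite RRe_real // gtr0_real.
  have re0 : 0 < complex.Re e by rewrite -ltcR -eR.
  have [N HN] := uC _ (exprn_gt0 2 re0).
  exists (u N); exists N => // m /= Nm.
  by rewrite -ball_normE /= eR lesq // HN.
exists (limn u) => e e0.
have se0 : 0 < Num.sqrt e by rewrite sqrtr_gt0.
have /cvgrPdist_lt/(_ (Num.sqrt e)%:C) := cvu.
rewrite ltcR => /(_ se0) [N _ HN]; exists N => n Nn.
by have := HN n Nn; rewrite lesq // sqr_sqrtr // ltW.
Qed.

Lemma sq_ge0 x : 0 <= sq x.
Proof. by rewrite -lecR sqE exprn_ge0. Qed.

(** The range of an isometry of a complete space is closed, so that the point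
    of it closest to [x] exists. A minimizing sequence is Cauchy by the
    parallelogram identity; the almost-minimality of its terms makes the
    residues almost orthogonal to the range, and this passes to the limit. *)
Lemma isometry_range_proj (V : {linear H -> H}) (x : H) :
  (forall y, `|V y| = `|y|) ->
  exists h, forall g, dot (x - V h) (V g) = 0.
Proof.
move=> iV.
have sqV y : sq (V y) = sq y by rewrite /sq iV.
have sqD u v : sq (u - v) = 2 * sq u + 2 * sq v - sq (u + v).
  apply: complexI; rewrite rmorphB rmorphD !rmorphM /= !sqE rmorph_nat.
  exact: parallelogram.
pose D h := sq (x - V h).
have infD : has_inf (range D).
  by split; [exists (D 0), 0 | exists 0 => _ [h _ <-]; exact: sq_ge0].
pose d := inf (range D).
have dD h : d <= D h by apply: ge_inf; [case: infD | exists h].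
have eN n : 0 < (n.+1%:R)^-1 :> R by rewrite invr_gt0.
have /choice [h Dh] : forall n, exists h, D h < d + (n.+1%:R)^-1.
  by move=> n; have [_ [h _ <-] hlt] := inf_adherent (eN n) infD; exists h.
have mid g k : sq (g - k) <= 2 * D g + 2 * D k - 4 * d.
  rewrite -sqV.
  have -> : sq (V (g - k)) = sq ((x - V k) - (x - V g)).
    by congr sq; rewrite linearB /= opprB [RHS]addrC addrA subrK.
  rewrite sqD -/(D g) -/(D k).
  have -> : sq (x - V k + (x - V g)) = 4 * D (2^-1 *: (g + k)).
    have -> : x - V k + (x - V g) = 2 *: (x - V (2^-1 *: (g + k))).
      rewrite [2 *: (_ - _)]scalerBr [V (_ *: _)]linearZ /= linearD /= scalerA divff ?pnatr_eq0 //.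
      rewrite scale1r scaler_nat mulr2n opprD.
      by rewrite addrACA [- V k - _]addrC.
    apply: complexI; rewrite sqE normrZ exprMn -sqE /D.
    rewrite rmorphM /= !rmorph_nat normr_nat -natrX //.
  by have := dD (2^-1 *: (g + k)); lra.
have small (e : R) : 0 < e -> exists N, forall n, (N <= n)%N -> (n.+1%:R)^-1 < e :> R.
  move=> e0; exists (Num.truncn e^-1) => n Nn.
  rewrite invf_plt ?posrE // (lt_le_trans (truncnS_gt _)) //.
  by rewrite ler_nat ltnS.
have [e e0|l Hl] := @complete_seq h.
  have e4 : 0 < e / 4 by lra.
  have [N HN] := small _ e4.
  exists N => n m /HN Nn /HN Nm.
  have := mid (h n) (h m); have := Dh n; have := Dh m; move: Nn Nm.
  by move: (n.+1%:R^-1) (m.+1%:R^-1) (D _) (D _) (sq _) => a1 a2 a3 a4 a5; lra.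
exists l => g; apply/eqP; rewrite -normr_eq0 -sqrf_eq0.
have -> : `|dot (x - V l) (V g)| ^+ 2 = (complex.Re (`|dot (x - V l) (V g)| ^+ 2))%:C.
  by rewrite RRe_real // realX.
set c := complex.Re _.
suff c0 : c <= 0.
  have /eqP -> : c == 0; last by [].
  rewrite eq_le c0 -lecR RRe_real ?exprn_ge0 //; exact: realX.
apply/ler_addgt0Pl => e e0; rewrite addr0.
pose G := sq g; have G0 : 0 <= G := sq_ge0 _.
(* The final estimate is c <= 2 (1 + G) e' + 2 G e' with e' = e / K. *)
pose K := 2 + 4 * G; have K0 : 0 < K by rewrite /K; lra.
have eK : 0 < e / K by rewrite divr_gt0.
have [N1 HN1] := small _ eK.
have [N2 HN2] := Hl _ eK.
pose n := maxn N1 N2.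
have := HN1 n (leq_maxl _ _); have := HN2 n (leq_maxr _ _).
set en := (n.+1%:R)^-1; move=> hl en0.
have Dn : D (h n) < d + en by exact: Dh.
clearbody en.
have [w wE] : exists w, w = x - V (h n) by exists (x - V (h n)).
pose cn := dot w (V g).
pose rn := complex.Re (`|cn| ^+ 2).
have rnE : rn%:C = `|cn| ^+ 2 by rewrite RRe_real // realX.
have rn0 : 0 <= rn by rewrite -lecR rnE exprn_ge0.
(* Almost-minimality, tested along the line through h n directed by g: the
   phase of the increment is the one of cn, which makes the linear term real. *)
have var (s : R) : 0 <= D (h n) - 2 * s * rn + s * s * rn * G - d.
  suff <- : D (h n + (s%:C * cn) *: g) = D (h n) - 2 * s * rn + s * s * rn * G.
    by rewrite subr_ge0.
  apply: complexI.
  rewrite /D rmorphD rmorphB !rmorphM /= !sqE rnE.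
  have -> : x - V (h n + (s%:C * cn) *: g) = w - (s%:C * cn) *: V g.
    by rewrite wE linearD linearZ /= opprD addrA.
  rewrite -!dot_norm -wE.
  rewrite !(dotBl, dotBr, dotZl, dotZr) (dotC (V g) w) -/cn.
  have -> : dot (V g) (V g) = dot g g by rewrite !dot_norm iV.
  rewrite rmorphM /= normCK.
  have -> : (s%:C)^* = s%:C by apply/conj_Creal/complex_realP; exists s.
  rewrite rmorph_nat; ring.
(* The choice s = 1 / (1 + G) ensures s * G <= 1, even when g = 0. *)
have rn_le : rn <= (1 + G) * en.
  have G1 : 0 < 1 + G by lra.
  have := var (1 + G)^-1.
  set s := _^-1.
  have s0 : 0 < s by rewrite invr_gt0.
  have sG : s * (1 + G) = 1 by rewrite /s mulVf // gt_eqF.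
  clearbody s.
  have -> : s * s * rn * G = s * rn * (s * (1 + G) - s) by ring.
  rewrite sG => D2.
  have D3 : s * rn * s >= 0 by rewrite !mulr_ge0 // ltW.
  have : s * rn <= en by clear -D2 Dn D3; clearbody d; move: (D _) D2 Dn => D0; nra.
  rewrite -(ler_pM2l G1) mulrA [_ * s]mulrC sG mul1r //.
(* The error made by replacing h n with its limit. *)
pose z := dot (V (l - h n)) (V g).
pose zn := complex.Re (`|z| ^+ 2).
have znE : zn%:C = `|z| ^+ 2 by rewrite RRe_real // realX.
have zn_le : zn <= sq (l - h n) * G.
  rewrite -lecR znE rmorphM /= !sqE -!(iV (l - h n)) -(iV g).
  exact: dot_cauchy_schwarz.
have c_le : c <= 2 * rn + 2 * zn.
  rewrite -lecR RRe_real ?realX // rmorphD !rmorphM /= rnE znE rmorph_nat.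
  have -> : dot (x - V l) (V g) = cn - z.
    by rewrite /cn /z -dotBl linearB /= opprB wE addrA subrK.
  rewrite -subr_ge0.
  have -> : 2 * `|cn| ^+ 2 + 2 * `|z| ^+ 2 - `|cn - z| ^+ 2 = `|cn + z| ^+ 2.
    by rewrite !normCK !rmorphD rmorphN /=; ring.
  exact: exprn_ge0.
have h1 : sq (l - h n) * G <= e / K * G by rewrite ler_wpM2r // ltW.
have h2 : (1 + G) * en <= (1 + G) * (e / K) by rewrite ler_wpM2l //; lra.
have -> : e = K * (e / K) by rewrite mulrCA divff ?mulr1 // gt_eqF.
move: h1 h2; set q := e / K; rewrite /K; nra.
Qed.
End Hilbert.

(** * Polynomials in commuting operators *)

Lemma iter_linear (K : pzRingType) (U : lmodType K) (f : {linear U -> U}) k :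
  linear (iter k f).
Proof. by elim: k => [|k IH] a x y //=; rewrite IH linearP. Qed.
HB.instance Definition _ (K : pzRingType) (U : lmodType K)
    (f : {linear U -> U}) k :=
  GRing.isLinear.Build K U U *:%R (iter k f) (iter_linear f k).

Section PolyAction.
Variables (R : realType) (H : completeNormedModType R[i]) (n : nat).
Variable V : 'I_n -> {linear H -> H}.
Implicit Types (m : multinom n) (p q : cpoly R n) (x y : H).

Lemma monom_op_linear m : linear (monom_op V m).
Proof.
rewrite /monom_op; elim/big_rec: _ => [|i f _ IH] a x y //=.
by rewrite IH linearP.
Qed.
HB.instance Definition _ m :=
  GRing.isLinear.Build R[i] H H *:%R (monom_op V m) (monom_op_linear m).

Lemma poly_op_linear p : linear (poly_op V p).
Proof.
move=> a x y; rewrite /poly_op scaler_sumr -big_split /=; apply: eq_bigr => m _.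
by rewrite linearP scalerDr !scalerA mulrC.
Qed.
HB.instance Definition _ p :=
  GRing.isLinear.Build R[i] H H *:%R (poly_op V p) (poly_op_linear p).

(** Summing over all monomials of bounded degree puts two polynomials on a
    common index set. *)
Lemma poly_op_widen k p x : (mmeasure mdeg p <= k)%N ->
  poly_op V p x = \sum_(m : bmultinom n k) mcoeff m p *: monom_op V m x.
Proof.
move=> lt_pk; rewrite /poly_op (big_mksub (bmultinom n k)) /=; first last.
- by move=> m /msize_mdeg_lt /leq_trans; apply.
- exact: msupp_uniq.
by rewrite big_rmcond //= => i /memN_msupp_eq0 ->; rewrite scale0r.
Qed.

Lemma poly_opD p q x : poly_op V (p + q) x = poly_op V p x + poly_op V q x.
Proof.
pose k := maxn (mmeasure mdeg p) (mmeasure mdeg q).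
rewrite !(@poly_op_widen k) ?leq_maxl ?leq_maxr ?mmeasureD_le //.
by rewrite -big_split; apply: eq_bigr => m _; rewrite mcoeffD scalerDl.
Qed.

Lemma poly_opZ c p x : poly_op V (c *: p) x = c *: poly_op V p x.
Proof.
rewrite !(@poly_op_widen (mmeasure mdeg p)) ?mmeasureZ_le //.
by rewrite scaler_sumr; apply: eq_bigr => m _; rewrite mcoeffZ scalerA.
Qed.

Lemma poly_op0 x : poly_op V 0 x = 0.
Proof. by rewrite -(scale0r 0) poly_opZ scale0r. Qed.

Lemma poly_opB p q x : poly_op V (p - q) x = poly_op V p x - poly_op V q x.
Proof. by rewrite -scaleN1r poly_opD poly_opZ scaleN1r. Qed.

Lemma poly_op_sum (I : Type) (r : seq I) (P : pred I) (F : I -> cpoly R n) x :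
  poly_op V (\sum_(i <- r | P i) F i) x = \sum_(i <- r | P i) poly_op V (F i) x.
Proof.
by apply: (big_morph (fun p => poly_op V p x)) => [p q|];
  rewrite ?poly_opD ?poly_op0.
Qed.

Lemma poly_op_mpolyX m x : poly_op V (mpolyX R[i] m) x = monom_op V m x.
Proof. by rewrite /poly_op msuppX big_seq1 mcoeffX eqxx scale1r. Qed.

Hypothesis V_comm : forall i j x, V i (V j x) = V j (V i x).

Lemma monom_op_add m1 m2 x :
  monom_op V (mnm_add m1 m2) x = monom_op V m1 (monom_op V m2 x).
Proof.
have comm m (r : seq 'I_n) j k y :
  iter k (V j) ((\big[comp/idfun]_(i <- r) iter (m i) (V i)) y)
  = (\big[comp/idfun]_(i <- r) iter (m i) (V i)) (iter k (V j) y).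
  elim: r => [|i r IH]; first by rewrite !big_nil.
  rewrite !big_cons /= -IH; elim: (m i) => //= a <-.
  by elim: k {IH} => //= b ->; rewrite V_comm.
rewrite /monom_op; elim: (index_enum _) => [|i r IH]; first by rewrite !big_nil.
by rewrite !big_cons /= IH mnmDE iterD comm.
Qed.

Lemma monom_op0 x : monom_op V mnm0 x = x.
Proof. by rewrite /monom_op; elim/big_rec: _ => // i f _; rewrite mnm0E. Qed.

Lemma monom_op1 i x : monom_op V (mnm1 i) x = V i x.
Proof.
rewrite /monom_op.
have : i \in index_enum 'I_n by rewrite mem_index_enum.
have : uniq (index_enum 'I_n) by exact: index_enum_uniq.
have notin (r : seq 'I_n) : i \notin r ->
    (\big[comp/idfun]_(j <- r) iter (mnm1 i j) (V j)) x = x.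
  elim: r => [|j r IH]; first by rewrite big_nil.
  rewrite inE negb_or big_cons /= => /andP[ij ir].
  by rewrite IH // mnm1E (negbTE ij).
elim: (index_enum _) => // j r IH /= /andP[jr ur].
rewrite inE big_cons /= mnm1E; case: (eqVneq i j) => [ij _|ij /=]; last exact: IH.
by rewrite /= notin ij.
Qed.

Lemma poly_opM p q x : poly_op V (p * q) x = poly_op V p (poly_op V q x).
Proof.
elim/mpolyind: p => [|c m p _ _ IH]; first by rewrite mul0r !poly_op0.
rewrite mulrDl !poly_opD {}IH -scalerAl !poly_opZ; congr (_ *: _ + _).
elim/mpolyind: q => [|d m' q _ _ IHq]; first by rewrite mulr0 !poly_op0 linear0.
rewrite mulrDr !poly_opD IHq linearD -scalerAr !poly_opZ linearZ /=.
by rewrite -mpolyXD !poly_op_mpolyX monom_op_add.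
Qed.

Lemma poly_op1 x : poly_op V 1 x = x.
Proof. by rewrite -mpolyX0 poly_op_mpolyX monom_op0. Qed.

Lemma poly_opX i x : poly_op V (mpolyX R[i] (mnm1 i)) x = V i x.
Proof. by rewrite poly_op_mpolyX monom_op1. Qed.

Lemma poly_op_comm p q x :
  poly_op V p (poly_op V q x) = poly_op V q (poly_op V p x).
Proof. by rewrite -!poly_opM mulrC. Qed.

Lemma poly_opXn p k x : poly_op V (p ^+ k) x = iter k (poly_op V p) x.
Proof. by elim: k => [|k IH] /=; rewrite ?poly_op1 // exprS poly_opM IH. Qed.
End PolyAction.

(** * Chains of irreducible sets in an algebraic set of dimension at most one *)

Section Zariski.
Variables (R : realType) (n : nat).
Local Notation C := R[i].
Local Notation point := ('I_n -> C).
Local Notation mp := (cpoly R n).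
Implicit Types (A B F Z : set point) (p q : mp) (a : point) (i : 'I_n).

Definition coordinate i : mp := mpolyX C (mnm1 i).

Lemma meval_coordinate a i : meval a (coordinate i) = a i.
Proof. exact: mevalXU. Qed.

Definition vanishes_on A p := forall a, A a -> meval a p = 0.

Lemma closed_vanishing A : zariski_closed A -> A = zero_set (vanishes_on A).
Proof.
case=> S ->; apply/seteqP; split=> a; first by move=> Sa p /(_ a Sa).
by move=> va p Sp; apply: va => b /(_ p Sp).
Qed.

Lemma closed_cap_hypersurface A p :
  zariski_closed A -> zariski_closed (A `&` [set a | meval a p = 0]).
Proof.
case=> S ->; exists (S `|` [set p]); apply/seteqP; split=> a.
  by case=> Sa pa q [/Sa //|->].
by move=> Sa; split; [move=> q Sq; apply: Sa; left | apply: Sa; right].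
Qed.

Lemma irreducible_prime F p q : zariski_irreducible F ->
  vanishes_on F (p * q) -> vanishes_on F p \/ vanishes_on F q.
Proof.
case=> cF _ irr vpq.
have [|||FE|FE] := irr (F `&` [set a | meval a p = 0])
    (F `&` [set a | meval a q = 0]).
- exact: closed_cap_hypersurface.
- exact: closed_cap_hypersurface.
- rewrite -setIUr; apply/seteqP; split=> [a Fa|a []//].
  split=> //; have /eqP := vpq a Fa.
  by rewrite mevalM mulf_eq0 => /orP[] /eqP; [left|right].
- by left=> a; rewrite FE => -[].
- by right=> a; rewrite FE => -[].
Qed.

(** Over an algebraically closed field [g] is a product of linear factors, and
    one of them has to vanish on the irreducible set. *)
Lemma irreducible_coordinate_const F i (g : {poly C}) :
  zariski_irreducible F -> g != 0 -> (forall a, F a -> g.[a i] = 0) ->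
  exists z, forall a, F a -> a i = z.
Proof.
move=> irrF g0 gF.
have [rs gE] := closed_field_poly_normal g.
have {gF} : vanishes_on F (\prod_(z <- rs) (coordinate i - mpolyC n z)).
  move=> a Fa; have /eqP := gF a Fa.
  rewrite gE hornerZ mulf_eq0 lead_coef_eq0 (negbTE g0) /= => /eqP.
  rewrite horner_prod rmorph_prod /= => <-.
  apply: eq_bigr => z _; rewrite hornerXsubC rmorphB /= meval_coordinate.
  by rewrite mevalC.
elim: rs {gE} => [|z rs IH].
  rewrite big_nil => F1; case: irrF => _ [a /F1].
  by rewrite meval1 => /eqP; rewrite oner_eq0.
rewrite big_cons => /(irreducible_prime irrF)[vz|/IH//].
exists z => a /vz /eqP; rewrite mevalB meval_coordinate mevalC subr_eq0.
by move/eqP.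
Qed.

(** The polynomial c(X_i, q), where the inner variable of [c] is X_i and the
    outer one is [q]. *)
Definition bieval i (c : {poly {poly C}}) q : mp :=
  (map_poly (horner_alg (coordinate i)) c).[q].

Lemma meval_bieval a i c q :
  meval a (bieval i c q) = (map_poly (horner_eval (a i)) c).[meval a q].
Proof.
rewrite /bieval -horner_map -map_poly_comp; congr (_.[_]).
apply: eq_map_poly => g /=; rewrite /horner_eval /horner_alg /horner_morph.
rewrite -horner_map /= meval_coordinate -map_poly_comp /=.
rewrite map_poly_id // => x _ /=.
by rewrite mevalZ meval1 mulr1.
Qed.

Lemma bievalMX i c q : bieval i (c * 'X) q = bieval i c q * q.
Proof. by rewrite /bieval rmorphM /= map_polyX hornerMX. Qed.

(** Dividing a relation c(X_i, q) = 0 on [F2] by the largest possible power of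
    [q], which is allowed since [F2] is irreducible, makes c(_, 0) nonzero; as
    [q] vanishes on [F1], what remains there is c(X_i, 0) = 0. *)
Lemma bieval_cancel F1 F2 i q (c : {poly {poly C}}) :
  zariski_irreducible F2 -> F1 `<=` F2 ->
  vanishes_on F1 q -> ~ vanishes_on F2 q ->
  c != 0 -> vanishes_on F2 (bieval i c q) ->
  exists2 g : {poly C}, g != 0 & forall a, F1 a -> g.[a i] = 0.
Proof.
move=> irr F12 q1 q2; elim/poly_ind: c => [|c c0 IH]; first by rewrite eqxx.
have [-> | c0_neq0 _ vc] := eqVneq c0 0.
  rewrite polyC0 addr0 => cX0 vcX; apply: IH.
    by apply: contraNneq cX0 => ->; rewrite mul0r.
  rewrite bievalMX in vcX.
  by case: (irreducible_prime irr vcX) => // /q2.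
exists c0 => // a Fa; have := vc a (F12 a Fa).
by rewrite meval_bieval q1 // rmorphD rmorphM /= map_polyX map_polyC /= !hornerE.
Qed.

(** This is the bound of the dimension by a transcendence degree, without
    function fields: in a chain F0 < F1 < F2, a polynomial [q] vanishing on F1
    but not on F2 is related to each coordinate, so that every coordinate is
    constant on F1, which is then a point. *)
Lemma chain_length_le1 Z :
  (forall i q, exists2 c : {poly {poly C}}, c != 0 &
     vanishes_on Z (bieval i c q)) ->
  forall e (Fs : 'I_e.+1 -> set point),
    @irreducible_chain R n Z e Fs -> (e <= 1)%N.
Proof.
move=> alg e Fs [irrF subF ltF]; rewrite leqNgt; apply/negP => e2.
pose F0 := Fs (inord 0); pose F1 := Fs (inord 1); pose F2 := Fs (inord 2).
have v k : (k <= 2)%N -> (inord k : 'I_e.+1) = k :> nat.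
  by move=> k2; rewrite inordK // ltnS (leq_trans k2).
have [F01 nF10] : F0 `<` F1 by apply: ltF; rewrite !v.
have [F12 nF21] : F1 `<` F2 by apply: ltF; rewrite !v.
have [q q1 q2] : exists2 q, vanishes_on F1 q & ~ vanishes_on F2 q.
  apply: contrapT => noq; apply: nF21 => a F2a.
  have [cF1 _ _] : zariski_irreducible F1 := irrF (inord 1).
  rewrite (closed_vanishing cF1) => q vq; apply: contrapT => qa.
  by apply: noq; exists q => // /(_ a F2a).
have cst i : exists z, forall a, F1 a -> a i = z.
  have [c c0 vc] := alg i q.
  have [g g0 gF] : exists2 g : {poly C}, g != 0 & forall a, F1 a -> g.[a i] = 0.
    apply: bieval_cancel (irrF (inord 2)) F12 q1 q2 c0 _ => a /subF; exact: vc.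
  exact: irreducible_coordinate_const (irrF (inord 1)) g0 gF.
have [z zE] := choice cst.
have [_ [a F0a] _] := irrF (inord 0).
apply: nF10 => b F1b; suff -> : b = a by [].
by apply: funext => i; rewrite (zE i b F1b) (zE i a (F01 a F0a)).
Qed.

End Zariski.

(** * Noetherianity and existence of irreducible sets of positive dimension *)

Lemma nat_seq_nondecreasing_subseq (f : nat -> nat) :
  exists2 phi : nat -> nat, {homo phi : i j / (i < j)%N} &
    {homo f \o phi : i j / (i <= j)%N}.
Proof.
have minf N : exists k, (N <= k)%N /\ forall l, (N <= l)%N -> (f k <= f l)%N.
  suff : forall v k, (N <= k)%N -> (f k <= v)%N ->
      exists k, (N <= k)%N /\ forall l, (N <= l)%N -> (f k <= f l)%N.
    by move/(_ (f N) N (leqnn _) (leqnn _)).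
  elim=> [|v IH] k Nk fk.
    by exists k; split=> // l _; move: fk; rewrite leqn0 => /eqP ->.
  have [[l [Nl fl]]|nex] := pselect (exists l, (N <= l)%N /\ (f l <= v)%N).
    exact: IH Nl fl.
  exists k; split=> // l Nl; apply: leq_trans fk _; rewrite ltnNge.
  by apply/negP => fl; apply: nex; exists l.
have [g gP] := choice minf.
pose phi := fix phi j := if j is j'.+1 then g (phi j').+1 else g 0%N.
exists phi; first apply: homo_ltn; first exact: ltn_trans.
  by move=> j /=; have [] := gP (phi j).+1.
apply: (@homo_leq _ _ (fun x y => (x <= y)%N)) => //; first exact: leq_trans.
have lt_phi j : exists N, phi j = g N /\ (N <= phi j)%N.
  by case: j => [|j]; [exists 0%N | exists (phi j).+1];
     split=> //; have [] := gP (phi j).+1.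
move=> j; have [N [phiN Nphi]] := lt_phi j.
have [_ gmin] := gP N; rewrite /= -/(phi j) phiN gmin //.
rewrite -phiN; have [] := gP (phi j).+1; move=> + _; apply: leq_trans.
exact: leqW.
Qed.

(** Extract successive subsequences, one for each coordinate. *)
Lemma multinom_seq_good n (t : nat -> multinom n) :
  exists j k, (j < k)%N /\ lem (t j) (t k).
Proof.
have sub d : (d <= n)%N ->
    exists2 phi : nat -> nat, {homo phi : i j / (i < j)%N} &
    forall i : 'I_n, (i < d)%N -> {homo (fun j => t (phi j) i) : j k / (j <= k)%N}.
  elim: d => [|d IH] dn; first by exists id.
  have [phi phi1 phi2] := IH (ltnW dn).
  have [psi psi1 psi2] := nat_seq_nondecreasing_subseq
     (fun j => t (phi j) (Ordinal dn)).
  exists (phi \o psi) => [j k jk|i]; first exact/phi1/psi1.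
  rewrite ltnS leq_eqVlt => /orP[/eqP id|id] j k jk.
    have -> : i = Ordinal dn by apply: val_inj.
    exact: psi2.
  by apply: phi2 => //; apply: (ltnW_homo psi1).
have [phi phi1 phi2] := sub n (leqnn n); exists (phi 0%N), (phi 1%N).
split; first exact: phi1.
by apply/mnm_lepP => i; apply: phi2.
Qed.

(** If no finite subset dominates [M], iterating the choice of an element that
    is not dominated by the previous ones produces a sequence contradicting
    [multinom_seq_good]. *)
Lemma dickson n (M : set (multinom n)) :
  exists s : seq (multinom n), (forall m, m \in s -> M m) /\
    forall m, M m -> exists2 m0, m0 \in s & lem m0 m.
Proof.
apply: contrapT => noS.
have : forall s : seq (multinom n), exists m, (forall m0, m0 \in s -> M m0) ->
    M m /\ forall m0, m0 \in s -> ~~ lem m0 m.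
  move=> s; have [sM|nsM] := pselect (forall m0, m0 \in s -> M m0); last first.
    by exists mnm0 => /nsM.
  apply: contrapT => nom; apply: noS; exists s; split=> // m Mm.
  apply: contrapT => nos; apply: nom; exists m => _; split=> // m0 m0s.
  by apply/negP => le; apply: nos; exists m0.
case/choice => f fP.
pose u := fix u k := if k is k'.+1 then f (u k') :: u k' else [::].
have uM k : forall m0, m0 \in u k -> M m0.
  elim: k => //= k IH m0; rewrite inE => /orP[/eqP ->|/IH//].
  by have [] := fP _ IH.
have uin j k : (j < k)%N -> f (u j) \in u k.
  elim: k => // k IH; rewrite ltnS leq_eqVlt /= inE.
  by case/orP=> [/eqP ->|/IH ->]; rewrite ?eqxx ?orbT.
have [j [k [jk le]]] := multinom_seq_good (fun k => f (u k)).
have [_ /(_ _ (uin _ _ jk))] := fP _ (uM k).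
by rewrite le.
Qed.

Section Noether.
Variables (R : realType) (n : nat).
Local Notation C := R[i].
Local Notation point := ('I_n -> C).
Local Notation mp := (cpoly R n).
Implicit Types (A B F Z : set point) (p q : mp) (a : point) (i : 'I_n).

(** The geometric content of the Hilbert basis theorem. Elements of the ideal
    whose leading monomials generate all its leading monomials form [G]: any
    element of the ideal reduces to one of smaller leading monomial by
    subtracting a multiple of an element of [G]. *)
Lemma ideal_finite_zero_set (I : set mp) :
  (forall p q r, I p -> I q -> I (p - r * q)) ->
  exists G : seq mp, (forall g, g \in G -> I g) /\
    forall a, (forall g, g \in G -> meval a g = 0) ->
      forall p, I p -> meval a p = 0.
Proof.
move=> idI.
have [s [sM sP]] := dickson [set m | exists p, [/\ I p, p != 0 & mlead p = m]].
have /choice[g gP] : forall m, exists p, m \in s -> [/\ I p, p != 0 & mlead p = m].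
  move=> m; have [ms|nms] := boolP (m \in s); last by exists 0.
  by have [p ?] := sM m ms; exists p.
exists (map g s); split=> [q /mapP[m ms ->]|a Ga]; first by have [] := gP m ms.
elim/mleadrect => p IH Ip.
have [->|p0] := eqVneq p 0; first exact: meval0.
have [m0 m0s le] := sP (mlead p) (ex_intro _ p (And3 Ip p0 erefl)).
have [Ig g0 gm] := gP m0 m0s.
pose c := mcoeff (mlead p) p / mcoeff m0 (g m0).
have lg0 : mcoeff m0 (g m0) != 0 by rewrite -{1}gm mleadc_eq0.
have lp0 : mcoeff (mlead p) p != 0 by rewrite mleadc_eq0.
have c0 : c != 0 by rewrite mulf_neq0 ?invr_eq0.
pose r : mp := c *: mpolyX C (mnm_sub (mlead p) m0).
have X0 : mpolyX C (mnm_sub (mlead p) m0) != 0.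
  by rewrite -mleadc_eq0 mleadXm mcoeffX eqxx oner_eq0.
have r0 : r != 0 by rewrite scaler_eq0 negb_or c0.
have lr : mlead r = mnm_sub (mlead p) m0 by rewrite mleadZ // mleadXm.
have lrg : mlead (r * g m0) = mlead p by rewrite mleadM // lr gm submK.
have crg : mcoeff (mlead p) (r * g m0) = mcoeff (mlead p) p.
  rewrite -{1}lrg mleadM // mleadcM lr gm mcoeffZ mcoeffX eqxx mulr1 /c.
  by rewrite divfK.
have -> : p = p - r * g m0 + r * g m0 by rewrite subrK.
rewrite mevalD mevalM [meval a (g m0)]Ga ?map_f // mulr0 addr0.
have [->|q0] := eqVneq (p - r * g m0) 0; first exact: meval0.
apply: IH; last exact: idI.
have := mleadB_le p (r * g m0); rewrite lrg joinxx le_eqVlt => /orP[/eqP lq|//].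
move: q0; rewrite -mleadc_eq0 lq mcoeffB crg subrr eqxx //.
Qed.

(** The image of [A] in the i-th coordinate line is Zariski dense, that is,
    infinite. *)
Definition dense_projection i A :=
  forall g : {poly C}, g != 0 -> exists2 a, A a & g.[a i] != 0.

Lemma dense_projectionU i A B : dense_projection i (A `|` B) ->
  dense_projection i A \/ dense_projection i B.
Proof.
move=> lAB; apply: contrapT => /not_orP[].
move=> /existsNP[f /not_implyP[f0 fA]] /existsNP[g /not_implyP[g0 gB]].
have [|a ABa] := lAB (f * g); first by rewrite mulf_neq0.
rewrite hornerM mulf_eq0 negb_or => /andP[fa ga].
by case: ABa => ?; [apply: fA | apply: gB]; exists a.
Qed.

Lemma dense_projectionS i A B :
  A `<=` B -> dense_projection i A -> dense_projection i B.
Proof. by move=> AB lA g /lA[a Aa ga]; exists a => //; apply: AB. Qed.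

(** Zorn's lemma applies because zero sets satisfy the descending chain
    condition: the polynomials vanishing on some member of a chain form an
    ideal, and finitely many of them, which all vanish on a single member,
    already cut out its zero set. *)
Lemma minimal_dense_projection i Z : zariski_closed Z -> dense_projection i Z ->
  exists F, [/\ zariski_closed F, F `<=` Z, dense_projection i F &
    forall B, zariski_closed B -> B `<=` F -> dense_projection i B -> B = F].
Proof.
move=> cZ lZ.
pose T := {A : set point | [/\ zariski_closed A, A `<=` Z & dense_projection i A]}.
pose z : T := exist _ Z (And3 cZ (@subset_refl _ Z) lZ).
pose le (s t : T) := `[< sval t `<=` sval s >].
have [||||[F [cF FZ lF]] minF] := @Zorn T le.
- by move=> t; apply/asboolP => x.
- by move=> r s t /asboolP rs /asboolP st; apply/asboolP => x /st /rs.
- move=> [s sP] [t tP] /asboolP st /asboolP ts; apply: eq_exist.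
  by apply/seteqP; split.
- move=> A totA; have [[t0 At0]|A0] := pselect (exists t, A t); last first.
    by exists z => s As; case: A0; exists s.
  pose I := [set p | exists2 t, A t & vanishes_on (sval t) p].
  have [|G [GI Gzero]] := @ideal_finite_zero_set I.
    move=> p q r [s As sp] [t At tq].
    have [/asboolP st|/asboolP ts] := totA s t As At; [exists t|exists s] => // a Aa;
      rewrite mevalB mevalM.
      by rewrite tq // sp ?mulr0 ?subr0 //; exact: st.
    by rewrite sp // tq ?mulr0 ?subr0 //; exact: ts.
  have [t1 At1 Gt1] : exists2 t, A t & forall g, g \in G -> vanishes_on (sval t) g.
    elim: {Gzero} G GI => [|g G IH] GI; first by exists t0.
    have [|t At Gt] := IH; first by move=> q qG; apply: GI; rewrite inE qG orbT.
    have [s As sg] := GI g (mem_head _ _).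
    have [/asboolP st|/asboolP ts] := totA s t As At; [exists t|exists s] => // q;
      rewrite inE => /orP[/eqP ->|qG] a ta.
    - by apply: sg; exact: st.
    - exact: Gt ta.
    - exact: sg.
    - by apply: Gt qG _ _; exact: ts.
  have cI : zariski_closed (zero_set I) by exists I.
  have t1I : sval t1 `<=` zero_set I.
    by move=> a t1a; apply: Gzero => g gG; exact: Gt1 gG _ t1a.
  have Isub s : A s -> zero_set I `<=` sval s.
    case: s => B [cB BZ lB] As a Ia /=; rewrite (closed_vanishing cB) => p Bp.
    by apply: Ia; exists (exist _ B (And3 cB BZ lB)).
  have IZ : zero_set I `<=` Z.
    apply: subset_trans (Isub _ At0) _.
    by case: (t0) => B [].
  have lI : dense_projection i (zero_set I).
    by apply: dense_projectionS t1I _; case: (t1) => B [].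
  exists (exist _ (zero_set I) (And3 cI IZ lI)) => s As; apply/asboolP.
  exact: Isub.
exists F; split=> // B cB BF lB.
have BZ : B `<=` Z by exact: subset_trans BF FZ.
by have /asboolP/minF [] : sval (exist _ B (And3 cB BZ lB) : T) `<=` F := BF.
Qed.

(** A minimal closed set with dense projection is irreducible: in a
    decomposition into two closed sets one of them has dense projection. *)
Lemma irreducible_dense_projection i Z : zariski_closed Z -> dense_projection i Z ->
  exists F, [/\ zariski_irreducible F, F `<=` Z & dense_projection i F].
Proof.
move=> cZ lZ; have [F [cF FZ lF minF]] := minimal_dense_projection cZ lZ.
exists F; split=> //; split=> //.
  by have [|a Fa _] := lF 1; [exact: oner_neq0 | exists a].
move=> B D cB cD FBD.
have [lB|lD] : dense_projection i B \/ dense_projection i D.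
- by apply: dense_projectionU; rewrite -FBD.
- by left; apply/esym/minF => //; rewrite FBD; apply: subsetUl.
- by right; apply/esym/minF => //; rewrite FBD; apply: subsetUr.
Qed.

Lemma irreducible_point a : zariski_irreducible [set a].
Proof.
split; last 1 first.
- move=> B D _ _ aBD.
  have sub E : E `<=` [set a] -> E a -> [set a] = E.
    by move=> Ea Eaa; apply/seteqP; split=> // b ->.
  have : (B `|` D) a by rewrite -aBD.
  by case=> h; [left|right]; apply: sub => //; rewrite aBD;
    [apply: subsetUl|apply: subsetUr].
- exists [set p | exists i, p = coordinate R i - mpolyC n (a i)].
  apply/seteqP; split=> [b -> p [i ->]|b zb].
    by rewrite mevalB meval_coordinate mevalC subrr.
  apply: funext => i.
  have /eqP := zb _ (ex_intro _ i erefl).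
  by rewrite mevalB meval_coordinate mevalC subr_eq0 => /eqP.
- by exists a.
Qed.

(** The chain is a point of an irreducible set with dense projection. *)
Lemma dense_projection_chain i Z : zariski_closed Z -> dense_projection i Z ->
  exists Fs : 'I_2 -> set point, @irreducible_chain R n Z 1 Fs.
Proof.
move=> cZ lZ; have [F [irrF FZ lF]] := irreducible_dense_projection cZ lZ.
have [|a Fa _] := lF 1; first exact: oner_neq0.
exists (fun j => if j == 0 then [set a] else F); split.
- by move=> j; case: ifP => _ //; exact: irreducible_point.
- by move=> j; case: ifP => _ // b ->; apply: FZ.
move=> j k jk.
have -> : j == 0 by rewrite -val_eqE /=; case: j k jk => [[|[]]] //= ? [[|[]]].
have -> : (k == 0) = false.
  by apply/negbTE; rewrite -val_eqE /=; case: k jk => [[|]] //=.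
split=> [b -> //|Fsub].
have [|b Fb] := lF ('X - (a i)%:P); first by rewrite polyXsubC_eq0.
by rewrite hornerXsubC (Fsub b Fb) subrr eqxx.
Qed.
End Noether.

(** * Algebraic relations between commuting shifts *)

Lemma underdetermined_system (K : fieldType) (I J : finType) (g : I -> J -> K) :
  (#|J| < #|I|)%N ->
  exists2 u : I -> K, exists i, u i != 0 & forall j, \sum_i u i * g i j = 0.
Proof.
move=> JI; pose A := \matrix_(i < #|I|, j < #|J|) g (enum_val i) (enum_val j).
have kA : kermx A != 0.
  rewrite -mxrank_eq0 mxrank_ker subn_eq0 -ltnNge.
  exact: leq_ltn_trans (rank_leq_col A) JI.
have /rowV0Pn[v /sub_kermxP vA v0] := kA.
exists (fun i => v 0 (enum_rank i)).
  apply: contrapT => v0'; case/eqP: v0; apply/rowP => j; rewrite mxE.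
  apply/eqP/negPn/negP => vj; apply: v0'; exists (enum_val j).
  by rewrite enum_valK.
move=> j; have /rowP/(_ (enum_rank j)) := vA; rewrite !mxE => {2}<-.
rewrite (reindex_onto enum_val enum_rank) => [|i _]; last exact: enum_rankK.
apply: eq_big => [i|i _]; first by rewrite enum_valK eqxx.
by rewrite enum_valK !mxE enum_rankK.
Qed.

Section Cofinite.
Variables (K : fieldType) (H : lmodType K).

(** Codimension at most [k], without forming a quotient. *)
Definition cofinite_range (A : H -> H) k := exists f : 'I_k -> H,
  forall x, exists (c : 'I_k -> K) y, x = \sum_i c i *: f i + A y.

Lemma cofinite_range_comp (A : {linear H -> H}) (B : H -> H) k l :
  cofinite_range A k -> cofinite_range B l -> cofinite_range (A \o B) (k + l).
Proof.
move=> [f fP] [g gP].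
exists (fun i => match fintype.split i with inl j => f j | inr j => A (g j) end) => x.
have [c [y ->]] := fP x; have [d [z ->]] := gP y.
exists (fun i => match fintype.split i with inl j => c j | inr j => d j end), z.
rewrite big_split_ord /= linearD addrA linear_sum; congr (_ + _ + _).
  by apply: eq_bigr => i _; rewrite (unsplitK (inl i)).
by apply: eq_bigr => i _; rewrite (unsplitK (inr i)) linearZ.
Qed.

Lemma cofinite_range_id : cofinite_range idfun 0.
Proof.
exists (fun=> 0) => x; exists (fun=> 0), x.
by rewrite big_ord0 add0r.
Qed.

Lemma cofinite_range_iter (A : {linear H -> H}) k a :
  cofinite_range A k -> cofinite_range (iter a A) (a * k).
Proof.
move=> Ak; elim: a => [|a IH]; first exact: cofinite_range_id.
exact: (cofinite_range_comp Ak IH).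
Qed.
End Cofinite.

Section Shifts.
Variables (R : realType) (H : completeNormedModType R[i]).
Variable dot : {dot H for @Num.conj R[i]}.
Hypothesis dot_norm : forall x : H, dot x x = `|x| ^+ 2.
Hypothesis H_neq0 : exists x : H, x != 0.
Variable n : nat.
Variable V : 'I_n -> {linear H -> H}.
Hypothesis V_shift : forall i, is_shift (V i).
Hypothesis V_mult : forall i, finite_multiplicity dot (V i).
Hypothesis V_comm : forall i j x, V i (V j x) = V j (V i x).
Local Notation C := R[i].
Local Notation mp := (cpoly R n).
Local Notation X := (coordinate R).
Local Notation "p · x" := (poly_op V p x) (at level 40).
Implicit Types (p q : mp) (x y : H) (i j : 'I_n).

Lemma poly_op_coordinate i x : X i · x = V i x.
Proof. exact: poly_opX. Qed.

Lemma poly_op_coordinateXn i s x : X i ^+ s · x = iter s (V i) x.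
Proof.
rewrite poly_opXn //; elim: s => //= s ->; exact: poly_op_coordinate.
Qed.

(** The wandering subspace of the Wold decomposition. *)
Definition wandering i : set H := [set e | forall h, dot e (V i h) = 0].

(** Polarization. *)
Lemma shift_dot i x y : dot (V i x) (V i y) = dot x y.
Proof.
pose D u v := dot (V i u) (V i v) - dot u v.
have D0 u : D u u = 0 by rewrite /D !dot_norm (V_shift i).1 subrr.
have DD u v : D u v + D v u = D (u + v) (u + v) - D u u - D v v.
  by rewrite /D linearD !(dotDl, dotDr); ring.
have Di : D x ('i *: y) + D ('i *: y) x = - 'i * (D x y - D y x).
  by rewrite /D linearZ /= !(dotZl, dotZr) conjCi; ring.
have {}DD u v : D u v + D v u = 0 by rewrite DD !D0 !subr0.
have /eqP := Di; rewrite DD eq_sym mulf_eq0 oppr_eq0 (negbTE (neq0Ci _)) /=.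
have /eqP := DD x y; rewrite addr_eq0 => /eqP ->.
rewrite -opprD oppr_eq0 -mulr2n mulrn_eq0 /= => /eqP Dyx.
have /eqP := DD x y; rewrite Dyx addr0 /D subr_eq0 => /eqP //.
Qed.

Lemma monom_dot m x y : dot (monom_op V m x) (monom_op V m y) = dot x y.
Proof.
rewrite /monom_op; elim: (index_enum _) => [|i r IH]; first by rewrite !big_nil.
by rewrite !big_cons /=; elim: (m i) => //= k; rewrite shift_dot.
Qed.

(** The generators of the kernel of the adjoint supplied by the finiteness
    hypothesis are replaced by their projections onto the orthogonal complement
    of the range of [V i]; they still generate it. This avoids identifying that
    complement with the kernel, which takes Riesz representation. *)
Lemma wandering_generates i : exists k (e : 'I_k -> H),
  (forall r, wandering i (e r)) /\
  forall x, exists (c : 'I_k -> C) y, x = \sum_r c r *: e r + V i y.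
Proof.
have adj0 y : wandering i y -> adjoint dot (V i) y = 0.
  move=> wy; rewrite /adjoint; case: xgetP => // z -> zP.
  apply: (dot_eq0 dot_norm); rewrite -zP dotC wy; exact: conjC0.
have [k [e [_ eP]]] := V_mult i.
have /choice[h hP] r := isometry_range_proj dot_norm (e r) (V_shift i).1.
exists k, (fun r => e r - V i (h r)); split=> // x.
have [y yP] := isometry_range_proj dot_norm x (V_shift i).1.
have [c cE] := eP _ (adj0 _ yP).
exists c, (y + \sum_r c r *: h r).
rewrite linearD linear_sum /= addrCA -big_split /= -[LHS](subrK (V i y)) addrC.
congr (_ + _); rewrite cE; apply: eq_bigr => r _.
by rewrite linearZ /= scalerBr subrK.
Qed.

Lemma cofinite_shift i : exists k, cofinite_range (V i) k.
Proof.
by have [k [e [_ eP]]] := wandering_generates i; exists k, e.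
Qed.

Lemma cofinite_monom m : exists k, cofinite_range (monom_op V m) k.
Proof.
rewrite /monom_op; elim: (index_enum _) => [|i r [k IH]].
  by rewrite big_nil; exists 0%N; apply: cofinite_range_id.
rewrite big_cons; have [l Vl] := cofinite_shift i.
exists (m i * l + k)%N.
exact: (@cofinite_range_comp _ _ (iter (m i) (V i)) _ _ _
  (cofinite_range_iter _ Vl) IH).
Qed.

(** If [p] acts as T and [u] as U, this says that the composite of the adjoint
    of T with U is again a polynomial [w] in the shifts. For isometries it
    happens as soon as [u] is a monomial divisible by those of [p]; it lets one
    compute with adjoints without leaving the commutative algebra of
    polynomials. *)
Definition adjoint_modulo p u w :=
  forall x y, dot (p · x) (u · y) = dot x (w · y).

Lemma adjoint_modulo1 u : adjoint_modulo 1 u u.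
Proof. by move=> x y; rewrite poly_op1. Qed.

Lemma adjoint_moduloM p u w p' u' w' :
  adjoint_modulo p u w -> adjoint_modulo p' u' w' ->
  adjoint_modulo (p * p') (u * u') (w * w').
Proof.
move=> a a' x y; rewrite !poly_opM // a (poly_op_comm V_comm w) a'.
by rewrite (poly_op_comm V_comm w').
Qed.

Lemma adjoint_moduloXn p u w s :
  adjoint_modulo p u w -> adjoint_modulo (p ^+ s) (u ^+ s) (w ^+ s).
Proof.
move=> a; elim: s => [|s IH]; first exact: adjoint_modulo1.
by rewrite !exprS; apply: adjoint_moduloM.
Qed.

Lemma adjoint_modulo_coordinate i : adjoint_modulo (X i) (X i) 1.
Proof. by move=> x y; rewrite poly_op1 // !poly_op_coordinate shift_dot. Qed.

(** With [m] a common multiple of the monomials of [q], each of those cancels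
    against [m] because monomials act by isometries. *)
Lemma adjoint_modulo_exists q :
  exists m q', adjoint_modulo q (mpolyX C m) q'.
Proof.
pose M := \big[@mnm_add n/mnm0]_(m <- msupp q) m.
have leM m : m \in msupp q -> lem m M.
  by move=> mq; rewrite /M (big_rem m mq) /= lem_addr.
exists M, (\sum_(m <- msupp q)
  (mcoeff m q)^* *: mpolyX C (mnm_sub M m)) => x y.
rewrite poly_op_sum dot_sumr {1}/poly_op dot_suml.
rewrite !big_seq; apply: eq_bigr => m mq.
rewrite poly_opZ dotZl dotZr conjCK !poly_op_mpolyX; congr (_ * _).
by rewrite -{1}(submK (leM m mq)) addmC monom_op_add // monom_dot.
Qed.

(** Writing x as a combination of the e_r plus V_i y shows that p x lies in the
    range of V_i, hence, by iteration, in the range of all its powers; their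
    intersection is zero for a shift. *)
Lemma annihilates_wandering i k (e : 'I_k -> H) p :
  (forall x, exists (c : 'I_k -> C) y, x = \sum_r c r *: e r + V i y) ->
  (forall r, p · e r = 0) -> Ann V p.
Proof.
move=> eP pe x.
have pV y : p · V i y = V i (p · y).
  by rewrite -!poly_op_coordinate poly_op_comm.
have : (\bigcap_j range (iter j (V i))) (p · x).
  move=> j _; elim: j x => [|j IH] x; first by exists (p · x).
  have [c [y ->]] := eP x; have [z _ zE] := IH y.
  exists z => //=; rewrite zE linearD /= pV.
  have -> : p · (\sum_r c r *: e r) = 0; last by rewrite add0r.
  rewrite (linear_sum (poly_op V p)) /=; apply: big1 => r _.
  by rewrite linearZ /= pe scaler0.
by rewrite (V_shift i).2.
Qed.

(** Dimension count. Let U be a monomial divisible by those of [q]. For a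
    wandering vector e of V_i, all vectors X_i^s q^t e with s <= a and t <= b are
    orthogonal to the range of X_i^(a+1) U^(b+1), whose codimension is bounded by
    (a + 1) k + (b + 1) K. The (a + 1) (b + 1) coefficients of a relation that
    kills k wandering vectors thus satisfy only k times as many equations, a
    number that is linear in a and b; for large a and b a nonzero solution
    exists. *)
Lemma algebraic_relation i q :
  exists2 c : {poly {poly C}}, c != 0 & Ann V (bieval i c q).
Proof.
have [k [e [we eP]]] := wandering_generates i.
have [m [q' qq']] := adjoint_modulo_exists q.
have [K mK] := cofinite_monom m.
pose U := mpolyX C m.
(* These make k ((a + 1) k + (b + 1) K) smaller than (a + 1) (b + 1). *)
pose a := (2 * k * K)%N; pose b := (2 * k * k)%N.
pose L := (a.+1 * k + b.+1 * K)%N.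
have [f fP] : cofinite_range (poly_op V (X i ^+ a.+1 * U ^+ b.+1)) L.
  have Vk : cofinite_range (V i) k by exists e.
  have := cofinite_range_iter b.+1 mK.
  move=> /(@cofinite_range_comp _ _ (iter a.+1 (V i)) _ _ _
    (cofinite_range_iter a.+1 Vk)).
  congr cofinite_range; apply: funext => x /=.
  rewrite poly_opM // poly_op_coordinateXn poly_opXn //.
  change (iter a.+1 (V i) (iter b.+1 (monom_op V m) x) =
          iter a.+1 (V i) (iter b.+1 (poly_op V U) x)).
  congr (iter a.+1 (V i) _).
  by apply: eq_iter => y; rewrite poly_op_mpolyX.
have [|u [[s0 t0] u0] uP] := @underdetermined_system C
   ('I_a.+1 * 'I_b.+1)%type ('I_k * 'I_L)%type
   (fun st rl => dot (X i ^+ st.1 * q ^+ st.2 · e rl.1) (f rl.2)).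
  rewrite !card_prod !card_ord /L /a /b; nia.
pose p := \sum_(st : 'I_a.+1 * 'I_b.+1) u st *: (X i ^+ st.1 * q ^+ st.2).
have pe r : p · e r = 0.
  (* p · e r is orthogonal to the f l by the linear system, and to the range
     of X_i^(a+1) U^(b+1) since that operator has a spare factor X_i. *)
  apply: (dot_eq0 dot_norm); have [c [y yE]] := fP (p · e r).
  rewrite {2}yE dotDr dot_sumr big1 ?add0r => [|l _]; last first.
    rewrite dotZr /p poly_op_sum dot_suml.
    have /= := uP (r, l) => ur.
    under eq_bigr do rewrite poly_opZ dotZl.
    by rewrite ur mulr0.
  rewrite /p poly_op_sum dot_suml big1 // => -[s t] _ /=.
  rewrite poly_opZ dotZl.
  have -> : X i ^+ a.+1 * U ^+ b.+1 =
     (X i ^+ s * U ^+ t) * (X i * (X i ^+ (a - s) * U ^+ (b.+1 - t))).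
    have sa : (s <= a)%N by rewrite -ltnS.
    have tb : (t <= b.+1)%N by rewrite ltnW.
    by rewrite exprS -{1}(subnKC sa) -{1}(subnKC tb) !exprD; ring.
  have -> : X i ^+ s * q ^+ t = (X i ^+ s * q ^+ t) * 1 by rewrite mulr1.
  have adj := adjoint_moduloM (adjoint_moduloM
    (adjoint_moduloXn s (adjoint_modulo_coordinate i)) (adjoint_moduloXn t qq'))
    (adjoint_modulo1 (X i * (X i ^+ (a - s) * U ^+ (b.+1 - t)))).
  rewrite adj expr1n mul1r mulrCA poly_opM // poly_op_coordinate we mulr0 //.
exists (\poly_(t < b.+1) \poly_(s < a.+1) u (inord s, inord t)).
  apply/eqP => /(congr1 (fun c : {poly {poly C}} => c`_t0`_s0)) /eqP.
  rewrite coef_poly ltn_ord coef_poly ltn_ord !inord_val !coef0.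
  by rewrite (negbTE u0).
suff -> : bieval i (\poly_(t < b.+1) \poly_(s < a.+1) u (inord s, inord t)) q = p.
  exact: annihilates_wandering eP pe.
rewrite /bieval !poly_def rmorph_sum horner_sum /p.
transitivity (\sum_(s < a.+1) \sum_(t < b.+1) u (s, t) *: (X i ^+ s * q ^+ t));
  last first.
  by rewrite pair_bigA; apply: eq_bigr => -[s t] _.
rewrite exchange_big /=.
apply: eq_bigr => t _.
rewrite map_polyZ /= map_polyXn hornerZ hornerXn poly_def rmorph_sum mulr_suml.
apply: eq_bigr => s _.
rewrite -mul_polyC rmorphM rmorphXn /= horner_algC horner_algX !inord_val.
by rewrite mulr_algl scalerAl.
Qed.

(** * Points of the zero set of the annihilator *)

(** The polynomial has fewer roots than there are numbers 1 / (m + 3). *)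
Lemma exists_small_nonroot (g : {poly C}) : g != 0 ->
  exists2 z : C, `|z| <= 3^-1 & g.[z] != 0.
Proof.
move=> g0; apply: contrapT => noz.
pose rs : seq C := [seq (m + 3)%:R^-1 | m <- iota 0 (size g)].
have : (size rs < size g)%N.
  apply: max_poly_roots => //.
    apply/allP => z /mapP[m _ ->]; apply/negPn/negP => gz; apply: noz.
    exists (m + 3)%:R^-1 => //.
    rewrite normfV normr_nat lef_pV2 ?posrE ?ltr0n ?addn_gt0 ?orbT //.
    by rewrite ler_nat leq_addl.
  rewrite map_inj_uniq ?iota_uniq // => j k /invr_inj /eqP.
  by rewrite eqr_nat eqn_add2r => /eqP.
by rewrite size_map size_iota ltnn.
Qed.

Lemma wandering_neq0 i : exists2 e, wandering i e & e != 0.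
Proof.
apply: contrapT => noe; case: H_neq0 => x /eqP; apply.
have : (\bigcap_j range (iter j (V i))) x.
  move=> j _; elim: j => [|j [y _ <-]]; first by exists x.
  have [h hP] := isometry_range_proj dot_norm y (V_shift i).1.
  exists h => //; rewrite iterSr; congr (iter j (V i) _).
  by apply/eqP; rewrite eq_sym -subr_eq0; apply/negPn/negP => ne; apply: noe;
    exists (y - V i h).
by rewrite (V_shift i).2.
Qed.

(** A nonzero wandering vector e = (V - z) h would satisfy
    |h| <= |e| + |z| |h| and |e|^2 <= |z| |e| |h|, which is impossible when
    |z| <= 1/3. *)
Lemma shift_sub_not_onto i (z : C) : `|z| <= 3^-1 ->
  exists e, forall h, e <> V i h - z *: h.
Proof.
move=> z3; have [e we e0] := wandering_neq0 i; exists e => h eE.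
pose N (x : H) := complex.Re `|x|.
have NE x : `|x| = real_complex R (N x) by rewrite /N RRe_real ?normr_real.
have N0 x : 0 <= N x by rewrite -lecR -NE normr_ge0.
pose t := complex.Re `|z|.
have tE : `|z| = real_complex R t by rewrite /t RRe_real ?normr_real.
have t3 : t <= 3^-1 by rewrite -lecR -tE fmorphV rmorph_nat.
have t0 : 0 <= t by rewrite -lecR -tE normr_ge0.
have h1 : N h <= N e + t * N h.
  rewrite -lecR rmorphD rmorphM /= -!NE -tE -normrZ.
  by rewrite -((V_shift i).1 h) -[V i h](subrK (z *: h)) -eE ler_normD.
have h2 : N e ^+ 2 <= t * (N e * N h).
  rewrite -lecR rmorphXn !rmorphM /= -!NE -tE -dot_norm.
  have -> : dot e e = - (z^* * dot e h).
    by rewrite {2}eE dotBr we dotZr sub0r.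
  have ee : `|- (z^* * dot e h)| = - (z^* * dot e h).
    rewrite ger0_norm //.
    have -> : - (z^* * dot e h) = dot e e.
      by rewrite {3}eE dotBr we dotZr sub0r.
    by rewrite dot_norm exprn_ge0.
  rewrite -ee normrN normrM norm_conjC ler_wpM2l //.
  rewrite -(ler_pXn2r (n:=2)) ?nnegrE ?mulr_ge0 // exprMn.
  exact: dot_cauchy_schwarz.
have e1 : 0 < N e by rewrite -ltcR -NE normr_gt0.
have h3 : t * N h <= 3^-1 * N h by rewrite ler_wpM2r.
have h4 : t * N h <= 2^-1 * N e by lra.
have h5 : N e * (t * N h) <= N e * (2^-1 * N e) by rewrite ler_wpM2l.
have h6 : 0 < N e ^+ 2 by rewrite exprn_gt0.
have h7 : N e ^+ 2 <= 2^-1 * N e ^+ 2.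
  by apply: le_trans h2 _; rewrite expr2 mulrCA [leRHS]mulrCA.
suff : N e ^+ 2 <= 0 by rewrite leNgt h6.
by lra.
Qed.

(** Closure under scalars is closure under constant polynomials. *)
Definition submodule (J : set H) :=
  (forall x y, J x -> J y -> J (x + y)) /\ (forall p x, J x -> J (p · x)).

Definition add_range (J : set H) q : set H :=
  [set x | exists y h, J y /\ x = y + q · h].

Lemma submoduleZ J (c : C) x : submodule J -> J x -> J (c *: x).
Proof.
by move=> sJ /(sJ.2 (c *: 1)); rewrite poly_opZ poly_op1.
Qed.

Lemma submoduleB J x y : submodule J -> J x -> J y -> J (x - y).
Proof.
move=> sJ Jx Jy; apply: sJ.1 => //; rewrite -scaleN1r; exact: submoduleZ.
Qed.

Lemma submodule0 : submodule [set 0].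
Proof.
split=> [x y -> ->|p x ->]; first exact: addr0.
exact: (linear0 (poly_op V p)).
Qed.

Lemma submodule_add_range J q : submodule J -> submodule (add_range J q).
Proof.
case=> JD JM; split=> [_ _ [y [h [Jy ->]]] [y' [h' [Jy' ->]]]|p _ [y [h [Jy ->]]]].
  exists (y + y'), (h + h'); split; first exact: JD.
  by rewrite linearD addrACA.
exists (p · y), (p · h); split; first exact: JM.
by rewrite linearD /= (poly_op_comm V_comm p).
Qed.

Lemma sub_add_range J q : J `<=` add_range J q.
Proof. by move=> x Jx; exists x, 0; rewrite linear0 addr0. Qed.

Lemma add_range_range J q h : submodule J -> (exists x, J x) ->
  add_range J q (q · h).
Proof.
move=> sJ [x Jx]; exists 0, h; rewrite add0r; split=> //.
by rewrite -(subrr x); apply: submoduleB.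
Qed.

(** The eigenvalue argument for X_j acting on the quotient by [J]: if X_j - z
    were onto modulo [J] for every z, then so would be [g], which acts as zero
    there. *)
Lemma proper_add_range_root J j (g : {poly C}) :
  submodule J -> J <> setT -> g != 0 ->
  (forall h, J (horner_alg (X j) g · h)) ->
  exists z, add_range J (X j - mpolyC n z) <> setT.
Proof.
move=> sJ JT g0 gJ; apply: contrapT => noz.
have full z x : add_range J (X j - mpolyC n z) x.
  suff -> : add_range J (X j - mpolyC n z) = setT by [].
  by apply: contrapT => zT; apply: noz; exists z.
have [rs gE] := closed_field_poly_normal g.
have prodE : horner_alg (X j) g
    = lead_coef g *: \prod_(z <- rs) (X j - mpolyC n z).
  rewrite {1}gE -mul_polyC rmorphM /= horner_algC mulr_algl rmorph_prod /=.
  congr (_ *: _); apply: eq_bigr => z _.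
  by rewrite rmorphB /= horner_algX horner_algC alg_mpolyC.
have fullp s x : add_range J (\prod_(z <- s) (X j - mpolyC n z)) x.
  elim: s x => [|z s IH] x.
    have [y [h [Jy _]]] := full 0 0.
    by rewrite big_nil -[x](poly_op1 V); apply: add_range_range => //; exists y.
  rewrite big_cons; have [y [h [Jy ->]]] := full z x.
  have [y' [h' [Jy' ->]]] := IH h.
  exists (y + (X j - mpolyC n z) · y'), h'; split.
    by apply: sJ.1 => //; apply: sJ.2.
  by rewrite linearD addrA poly_opM.
apply: JT; rewrite -subTset => x _; have [y [h [Jy ->]]] := fullp rs x.
apply: sJ.1 => //; have := submoduleZ (lead_coef g)^-1 sJ (gJ h).
by rewrite prodE poly_opZ scalerA mulVf ?scale1r // lead_coef_eq0.
Qed.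

(** Modulo X_i - z, the polynomial c(X_i, q) is c(z, q). *)
Lemma bieval_specialize i (z : C) (c : {poly {poly C}}) q : exists r : mp,
  bieval i c q = horner_alg q (map_poly (horner_eval z) c)
                 + (X i - mpolyC n z) * r.
Proof.
elim/poly_ind: c => [|c c0 [r IH]].
  by exists 0; rewrite /bieval !rmorph0 horner0 mulr0 addr0.
have [d dE] : exists d, c0 - c0.[z]%:P = d * ('X - z%:P).
  by apply/factor_theorem; rewrite /root !hornerE subrr.
exists (r * q + horner_alg (X i) d).
rewrite /bieval rmorphD rmorphM /= map_polyX map_polyC /= !hornerE.
rewrite -/(bieval i c q) IH.
rewrite rmorphD rmorphM /= map_polyX map_polyC /= rmorphD rmorphM /=.
rewrite horner_algX horner_algC /horner_eval.
have -> : horner_alg (X i) c0 = c0.[z]%:A + horner_alg (X i) d * (X i - mpolyC n z).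
  rewrite -{1}(subrK c0.[z]%:P c0) dE rmorphD rmorphM rmorphB /=.
  by rewrite horner_algX !horner_algC alg_mpolyC addrC.
by ring.
Qed.

(** Modulo [J] each coordinate acts by a scalar, hence so does every
    polynomial. *)
Lemma congr_meval J (a : 'I_n -> C) p h : submodule J -> J h ->
  (forall i x, J ((X i - mpolyC n (a i)) · x)) ->
  forall x, J (p · x - meval a p *: x).
Proof.
move=> sJ Jh JX.
have J0 : J 0 by rewrite -(subrr h); apply: submoduleB.
pose P q := forall x, J (q · x - meval a q *: x).
have PM q r : P q -> P r -> P (q * r).
  move=> Pq Pr x; rewrite poly_opM // mevalM -scalerA.
  rewrite -(subrK (meval a q *: (r · x)) (q · (r · x))) -addrA -scalerBr.
  by apply: sJ.1; [exact: Pq | apply: submoduleZ].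
have P1 : P 1 by move=> x; rewrite poly_op1 // meval1 scale1r subrr.
have PX i : P (X i).
  move=> x; have := JX i x; rewrite poly_opB.
  rewrite -[mpolyC n (a i)]mulr1 mul_mpolyC poly_opZ poly_op1 //.
  by rewrite meval_coordinate.
rewrite -/(P p); elim/mpolyind: p => [|c m q _ _ IH] x.
  by rewrite poly_op0 meval0 scale0r subrr.
rewrite poly_opD poly_opZ mevalD mevalZ scalerDl opprD addrACA -scalerA -scalerBr.
apply: sJ.1; last exact: IH.
apply: submoduleZ => //; rewrite mpolyXE_id.
move: x; rewrite -/(P _); apply: big_ind => // i _.
elim: (m i) => [|k IHk]; first by rewrite expr0.
by rewrite exprS; apply: PM => //; exact: PX.
Qed.

(** Points of the zero set are joint eigenvalues of the shifts on quotients of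
    [H]. Start from the quotient by the range of V_i - z, nonzero for small z.
    For all but finitely many z the relation between V_i and V_j specializes to
    a nonzero polynomial in V_j that kills this quotient, so that quotients by
    the ranges of V_j - a_j can be taken one j after the other without reaching
    zero. A polynomial p acts on the last quotient as the scalar p(a), which
    vanishes if p annihilates the shifts; and a_i = z. *)
Lemma zero_set_Ann_dense_projection i : dense_projection i (zero_set (Ann V)).
Proof.
move=> g g0.
have /choice[c cP] j : exists c : {poly {poly C}},
    c != 0 /\ Ann V (bieval i c (X j)).
  by have [c] := algebraic_relation i (X j); exists c.
(* Excluding the roots of the leading coefficients keeps c j nonzero after
   specialization at z. *)
have [|z z3] := @exists_small_nonroot (g * \prod_j lead_coef (c j)).
  rewrite mulf_neq0 //; apply/prodf_neq0 => j _; rewrite lead_coef_eq0.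
  by have [] := cP j.
rewrite hornerM mulf_eq0 negb_or horner_prod => /andP[gz /prodf_neq0 cz].
pose J0 := add_range [set 0] (X i - mpolyC n z).
have sJ0 : submodule J0 by apply: submodule_add_range; exact: submodule0.
have XzE j t x : (X j - mpolyC n t) · x = V j x - t *: x.
  rewrite poly_opB -[mpolyC n t]mulr1 mul_mpolyC poly_opZ poly_op1 //.
  by rewrite poly_op_coordinate.
have J0T : J0 <> setT.
  have [e eP] := shift_sub_not_onto i z3.
  move=> J0T; have : J0 e by rewrite J0T.
  by case=> y [h [-> /eqP]]; rewrite add0r XzE => /eqP; exact: eP.
have J0z x : J0 ((X i - mpolyC n z) · x).
  by apply: add_range_range; [exact: submodule0 | exists 0].
pose gj j := map_poly (horner_eval z) (c j).
have gj0 j : gj j != 0.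
  apply: contraNneq (cz j isT) => /(congr1 (fun q : {poly C} => q`_(size (c j)).-1)).
  by rewrite coef_map coef0 => /eqP.
have gjJ0 j h : J0 (horner_alg (X j) (gj j) · h).
  have [r rE] := bieval_specialize i z (c j) (X j).
  have /eqP := (cP j).2 h; rewrite rE poly_opD addr_eq0 => /eqP ->.
  rewrite poly_opM // -scaleN1r; apply: submoduleZ => //; exact: J0z.
have [a [J [sJ JT J0J Ja]]] : exists (a : 'I_n -> C) J,
    [/\ submodule J, J <> setT, J0 `<=` J &
        forall j, (j < n)%N -> forall x, J ((X j - mpolyC n (a j)) · x)].
  suff build d : (d <= n)%N -> exists (a : 'I_n -> C) J,
    [/\ submodule J, J <> setT, J0 `<=` J &
        forall j, (j < d)%N -> forall x, J ((X j - mpolyC n (a j)) · x)].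
    exact: build.
  elim: d => [_|d IH dn]; first by exists (fun=> 0), J0; split=> // x.
  have [a [J [sJ JT J0J Ja]]] := IH (ltnW dn).
  pose jd := Ordinal dn.
  have [t tT] := proper_add_range_root sJ JT (gj0 jd) (fun h => J0J _ (gjJ0 jd h)).
  exists (fun j => if j == jd then t else a j), (add_range J (X jd - mpolyC n t)).
  split=> //; first exact: submodule_add_range.
    by apply: subset_trans J0J _; exact: sub_add_range.
  move=> j; rewrite ltnS leq_eqVlt => jd' x; case: eqP => [->|njd].
    apply: add_range_range => //; exists 0; apply: J0J.
    by have := J0z 0; rewrite linear0.
  case/orP: jd' => [/eqP jd'|jd']; first by case: njd; apply: val_inj.
  by apply: sub_add_range; exact: Ja.
have Jeq0 t : (forall x, J (t *: x)) -> t = 0.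
  move=> Jt; apply/eqP/negPn/negP => t0; apply: JT.
  rewrite -subTset => x _; have := Jt (t^-1 *: x).
  by rewrite scalerA divff // scale1r.
have Jh : J 0 by apply: J0J; have := J0z 0; rewrite linear0.
exists a.
  move=> p pV; apply: Jeq0 => x.
  have := congr_meval p sJ Jh (fun j => Ja j (ltn_ord j)) x.
  rewrite pV sub0r => /(submoduleZ (-1) sJ).
  by rewrite scaleN1r opprK.
suff -> : a i = z by [].
apply/eqP; rewrite -subr_eq0; apply/eqP/Jeq0 => x.
have := submoduleB sJ (J0J _ (J0z x)) (Ja i (ltn_ord i) x).
by rewrite !XzE opprB addrC addrA subrK scalerBl.
Qed.
End Shifts.

Theorem proposition6p3 (R : realType) (H : completeNormedModType R[i])
  (dot : {dot H for @Num.conj R[i]})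
  (dot_norm : forall x : H, dot x x = `|x| ^+ 2)
  (H_neq0 : exists x : H, x != 0)
  (n : nat) (n_gt0 : (0 < n)%N)
  (V : 'I_n -> {linear H -> H})
  (V_shift : forall i, is_shift (V i))
  (V_mult : forall i, finite_multiplicity dot (V i))
  (V_comm : forall i j x, V i (V j x) = V j (V i x)) :
  has_dim (zero_set (Ann V)) 1%N.
Proof.
split.
  apply: (@dense_projection_chain R n (Ordinal n_gt0)); first by exists (Ann V).
  exact: (zero_set_Ann_dense_projection dot_norm).
apply: chain_length_le1 => i q.
have [c c0 cV] := algebraic_relation dot_norm V_shift V_mult V_comm i q.
by exists c => // a; apply.
Qed.
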